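(* Let $K$ be a field of characteristic $2$, let $\mathcal L$ be the Fibonacci Lie algebra over $K$, let $\lambda=(1+\sqrt5)/2$, and let $\tilde\gamma_{\mathcal L}$ be its weight growth function. Then the limit $$\lim_{n\to\infty}\frac{\tilde\gamma_{\mathcal L}(n)}{n^{\log_\lambda 2}}$$ does not exist.
   Context: $R=K[t_i\mid i\ge 0]/(t_i^2\mid i\ge 0)$ is the truncated polynomial ring over $K$, and $\partial_i=\partial/\partial t_i\in\mathrm{Der}\,R$. The pivot elements are the derivations of $R$ $$v_i=\partial_i+t_{i-1}(\partial_{i+1}+t_i(\partial_{i+2}+t_{i+1}(\partial_{i+3}+\cdots))),\qquad i\ge 1,$$ so that $v_i=\partial_i+t_{i-1}v_{i+1}$. The Fibonacci Lie algebra $\mathcal L=\mathrm{Lie}(v_1,v_2)$ is the Lie subalgebra of $\mathrm{Der}\,R$ generated by $v_1,v_2$. It has the $K$-basis $W=\bigcup_{n\ge1}W_n$, where $W_n=\{t_0^{\alpha_0}\cdots t_{n-4}^{\alpha_{n-4}}v_n\mid\alpha_i\in\{0,1\}\}$ (so $W_i=\{v_i\}$ for $i=1,2,3$). The weight of a basis monomial is defined additively by $\mathrm{wt}(v_n)=\lambda^n$, $\mathrm{wt}(t_i)=-\lambda^i$, i.e. $\mathrm{wt}(t_0^{\alpha_0}\cdots t_{n-4}^{\alpha_{n-4}}v_n)=\lambda^n-\sum_{i=0}^{n-4}\alpha_i\lambda^i$. The weight growth function is $\tilde\gamma_{\mathcal L}(x)=\dim_K\langle w\in W\mid \mathrm{wt}(w)\le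 x\rangle_K$ for real $x\ge 0$, i.e. the number of $w\in W$ with $\mathrm{wt}(w)\le x$. *)

(* Defs.v *)
From HB Require Import structures.
From mathcomp Require Import all_boot all_order all_algebra.
From mathcomp Require Import generic_quotient ring_quotient finmap.
From mathcomp Require Import boolp classical_sets functions cardinality.
From mathcomp Require Import fsbigop reals.
From mathcomp.multinomials Require Import monalg.

Set Implicit Arguments.
Unset Strict Implicit.
Unset Printing Implicit Defensive.

Import Order.TTheory GRing.Theory Num.Theory.
Local Open Scope classical_set_scope.
Local Open Scope ring_scope.
Local Open Scope quotient_scope.

Section AlgebraQuotient.
Variables (K : nzRingType) (A : comAlgType K) (I : idealr A).

Definition alg_quot := {ideal_quot I}.
HB.instance Definition _ := GRing.ComNzRing.on alg_quot.
HB.instance Definition _ := NzRingQuotient.on alg_quot.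

Fact scale_quot_key : unit. Proof. by []. Qed.
Definition scale_quot (a : K) (x : alg_quot) : alg_quot :=
  locked_with scale_quot_key (\pi_alg_quot (a%:A * repr x)).

Lemma scale_quot_pi a (p : A) :
  scale_quot a (\pi_alg_quot p) = \pi_alg_quot (a *: p).
Proof. by rewrite /scale_quot unlock -[a *: p]mulr_algl !pi_mulr reprK. Qed.

Lemma scale_quotA a b x : scale_quot a (scale_quot b x) = scale_quot (a * b) x.
Proof. by rewrite -[x]reprK !scale_quot_pi scalerA. Qed.

Lemma scale_quot1 : left_id 1 scale_quot.
Proof. by move=> x; rewrite -[x]reprK !scale_quot_pi scale1r. Qed.

Lemma scale_quotDr : right_distributive scale_quot +%R.
Proof.
move=> a x y; rewrite -[x]reprK -[y]reprK.
by rewrite -pi_addr !scale_quot_pi scalerDr pi_addr.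
Qed.

Lemma scale_quotDl x : {morph scale_quot^~ x : a b / a + b}.
Proof. by move=> a b; rewrite -[x]reprK !scale_quot_pi scalerDl pi_addr. Qed.

Lemma scale_quotAl a (x y : alg_quot) : scale_quot a (x * y) = scale_quot a x * y.
Proof.
rewrite -[x]reprK -[y]reprK.
by rewrite -pi_mulr !scale_quot_pi scalerAl pi_mulr.
Qed.

HB.instance Definition _ := GRing.Zmodule_isLmodule.Build K alg_quot
  scale_quotA scale_quot1 scale_quotDr scale_quotDl.
HB.instance Definition _ :=
  GRing.Lmodule_isLalgebra.Build K alg_quot scale_quotAl.
HB.instance Definition _ := GRing.Lalgebra_isComAlgebra.Build K alg_quot.

End AlgebraQuotient.

Section TruncatedPolynomials.
Variable K : fieldType.
Local Notation P := {malg K[{cmonom nat}]}.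

Definition pvar (i : nat) : P := << ucm i >>.

Definition sq_ideal : {pred P} := fun p =>
  `[< exists s : seq (P * nat), p = \sum_(c <- s) c.1 * pvar c.2 ^+ 2 >].

Lemma sq_ideal_closed : idealr_closed sq_ideal.
Proof.
split.
- by apply/asboolP; exists [::]; rewrite big_nil.
- apply/asboolP => -[s] /(congr1 (@mcoeff {cmonom nat} K (@mone _))).
  rewrite rmorph1 rmorph_sum big1_seq => [/eqP|c _]; first by rewrite oner_eq0.
  by rewrite rmorphM rmorphXn /= mcoeffU1 cm1_eq1 expr0n mulr0.
- move=> a u v /asboolP [s ->] /asboolP [s' ->]; apply/asboolP.
  exists ([seq (a * c.1, c.2) | c <- s] ++ s').
  rewrite big_cat /=; congr (_ + _).
  rewrite big_map big_distrr /=.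
  by apply: eq_bigr => c _; rewrite mulrA.
Qed.

HB.instance Definition _ := isIdealr.Build P sq_ideal sq_ideal_closed.

Definition trunc_poly := alg_quot sq_ideal.

Definition tvar (i : nat) : trunc_poly := \pi_trunc_poly (pvar i).

(* divcm is truncated division of monomials: it is only used as m / t_i,    *)
(* since the coefficient vanishes when t_i does not occur in m.            *)
Definition poly_partial (i : nat) (p : P) : P :=
  \sum_(m <- msupp p) << p@_m *+ m i *g divcm m (ucm i) >>.

(* In characteristic 2 the partial derivatives of the polynomial ring       *)
(* preserve the ideal generated by the squares of the variables, so the    *)
(* result does not depend on the chosen representative and is a derivation;*)
(* in other characteristics this definition is not meaningful.             *)
Definition partial (i : nat) (x : trunc_poly) : trunc_poly :=
  \pi_trunc_poly (poly_partial i (repr x)).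

Definition derivations : set (trunc_poly -> trunc_poly) :=
  [set D | linear D /\ forall x y, D (x * y) = D x * y + x * D y].

(* v_i = d_i + t_{i-1} (d_{i+1} + t_i (d_{i+2} + ...)) with the nested      *)
(* parentheses expanded: the coefficient of d_{i+k} is the product of the  *)
(* k variables t_{i-1}, ..., t_{i+k-2}. Only finitely many terms are       *)
(* nonzero at a given x. Meaningful for i >= 1 only.                       *)
Definition pivot (i : nat) : trunc_poly -> trunc_poly := fun x =>
  \sum_(k \in [set: nat]) (\prod_(j < k) tvar (i.-1 + j)) * partial (i + k) x.

End TruncatedPolynomials.

Arguments pvar : clear implicits.
Arguments tvar : clear implicits.
Arguments partial : clear implicits.
Arguments pivot : clear implicits.
Arguments derivations : clear implicits.

Section Subspaces.
Variables (K : fieldType) (V : lmodType K).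

Definition subspace : set (set V) :=
  [set A | A 0 /\ forall a u v, A u -> A v -> A (a *: u + v)].

Definition lin_span (S : set V) : set V := smallest subspace S.

Definition is_basis (d : nat) (A : set V) (b : 'I_d -> V) : Prop :=
  [/\ forall i, A (b i),
      forall c : 'I_d -> K, \sum_i c i *: b i = 0 -> forall i, c i = 0
    & forall v, A v -> exists c : 'I_d -> K, v = \sum_i c i *: b i].

(* 0 by convention when A is not finite-dimensional *)
Definition dimension (A : set V) : nat :=
  xget 0%N [set d | exists b : 'I_d -> V, is_basis A b].

End Subspaces.

Section FibonacciLieAlgebra.
Variable K : fieldType.
Local Notation T := (trunc_poly K).

Definition bracket (D E : T -> T) : T -> T := fun x => D (E x) - E (D x).

Definition lie_subalgebra : set (set (T -> T)) :=
  [set A | [/\ A `<=` derivations K, subspace A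
             & forall D E, A D -> A E -> A (bracket D E)]].

Definition fibonacci_lie : set (T -> T) :=
  smallest lie_subalgebra [set pivot K 1; pivot K 2].

(* t_0^{a_0} ... t_{n-4}^{a_{n-4}} v_n; truncated subtraction makes the     *)
(* exponent vector empty for n <= 3.                                       *)
Definition fib_monomial (n : nat) (alpha : {ffun 'I_(n - 3) -> bool}) :
    T -> T :=
  fun x => (\prod_(i < n - 3) tvar K i ^+ alpha i) * pivot K n x.

Variable R : realType.

Definition golden : R := (1 + Num.sqrt 5) / 2.

Definition weight (n : nat) (alpha : {ffun 'I_(n - 3) -> bool}) : R :=
  golden ^+ n - \sum_(i < n - 3) (alpha i)%:R * golden ^+ i.

Definition basis_upto (x : R) : set (T -> T) :=
  [set w | exists n (alpha : {ffun 'I_(n - 3) -> bool}),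
     [/\ (0 < n)%N, weight alpha <= x & w = fib_monomial alpha]].

(* The monomials form a basis of the Fibonacci Lie algebra, hence the       *)
(* intersection is their whole span.                                       *)
Definition weight_growth (x : R) : nat :=
  dimension (fibonacci_lie `&` lin_span (basis_upto x)).

End FibonacciLieAlgebra.

Arguments fibonacci_lie : clear implicits.
Arguments golden : clear implicits.
Arguments weight_growth K {R} x.

(* Main.v *)
(* In characteristic 2 one has [v_i, v_{i+1}] = v_{i+2} and [v_i, v_{i+2}] = t_{i-1} v_{i+3}.
   Bracketing t^b v_n with v_{n-1} or v_{n-2}, both of which kill t^b for b supported below n-3,
   gives t^b v_{n+1} and t^b t_{n-3} v_{n+1}, so all monomials of W lie in the Fibonacci Lie
   algebra; evaluating at t_1, t_2, ... shows that they are independent. Hence the weight growth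
   function counts monomials.
   A monomial with head v_n weighs between lambda^{n-1} and lambda^n, so about 2^m / 4 monomials
   have weight at most lambda^m, and the ratio tends to 1/4 along x = lambda^m. But for
   x = lambda^m + lambda^{m-10} there are at most 2^{m-10} further monomials, while
   x^{log_lambda 2} >= 2^m (1 + lambda^{-10}), and 1/4 + 2^{-10} < (1 + lambda^{-10}) / 4. *)

From HB Require Import structures.
Require Import Defs.
From mathcomp Require Import all_boot all_order all_algebra.
From mathcomp Require Import generic_quotient ring_quotient finmap.
From mathcomp Require Import all_classical all_reals all_analysis.
From mathcomp.multinomials Require Import -(notations) monalg.
From mathcomp Require Import lra ring zify.
Import Order.TTheory GRing.Theory Num.Theory.
Import numFieldNormedType.Exports.

Set Implicit Arguments.
Unset Strict Implicit.
Unset Printing Implicit Defensive.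

Local Open Scope classical_set_scope.
Local Open Scope ring_scope.

(** * Leibniz rule on sums of terms, and descent of operators to a quotient *)

Lemma leibniz_sum (A : pzRingType) (I J : Type) (r : seq I) (s : seq J)
    (F : I -> A) (G : J -> A) (f : A -> A) :
    f 0 = 0 -> {morph f : x y / x + y} ->
    (forall i j, f (F i * G j) = f (F i) * G j + F i * f (G j)) ->
  f ((\sum_(i <- r) F i) * (\sum_(j <- s) G j)) =
  f (\sum_(i <- r) F i) * (\sum_(j <- s) G j) + (\sum_(i <- r) F i) * f (\sum_(j <- s) G j).
Proof.
move=> f0 fD fFG; elim/big_ind: (\sum_(i <- r) F i) => [|x y IHx IHy|i _].
- by rewrite !mul0r f0 mul0r addr0.
- by rewrite mulrDl !fD !mulrDl IHx IHy addrACA.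
elim/big_ind: (\sum_(j <- s) G j) => [|x y IHx IHy|j _].
- by rewrite !mulr0 f0 mulr0 addr0.
- by rewrite mulrDr !fD !mulrDr IHx IHy addrACA.
exact: fFG.
Qed.

Lemma linear_descent (K : pzRingType) (V W : lmodType K) (pi : V -> W) (rep : W -> V)
    (f : V -> V) (g : W -> W) : cancel rep pi -> linear pi -> linear f ->
  (forall x, g (pi x) = pi (f x)) -> linear g.
Proof.
move=> repK piP fP gE a x y; rewrite -[x]repK -[y]repK.
by rewrite -piP !gE fP piP.
Qed.

Lemma leibniz_descent (A B : pzRingType) (pi : A -> B) (rep : B -> A)
    (f : A -> A) (g : B -> B) : cancel rep pi ->
  {morph pi : x y / x + y} -> {morph pi : x y / x * y} ->
  (forall x y, f (x * y) = f x * y + x * f y) -> (forall x, g (pi x) = pi (f x)) ->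
  forall x y, g (x * y) = g x * y + x * g y.
Proof.
move=> repK piD piM fM gE x y; rewrite -[x]repK -[y]repK.
by rewrite -piM !gE fM piD !piM.
Qed.

(** * Pivots of an abstract system of commuting partial derivatives *)

Section Derivations.
Variable A : comPzRingType.

Lemma additive_eq0 (f : A -> A) : {morph f : x y / x + y} -> f 0 = 0.
Proof. by move=> fD; apply: (addrI (f 0)); rewrite -fD !addr0. Qed.

Lemma derivation1 (f : A -> A) : (forall x y, f (x * y) = f x * y + x * f y) -> f 1 = 0.
Proof. by move=> fM; apply: (addrI (f 1)); rewrite addr0 -[in RHS](mulr1 1) fM mulr1 mul1r. Qed.

Lemma derivation_prod0 (f : A -> A) (I : Type) (r : seq I) (P : pred I) (F : I -> A) :
    (forall x y, f (x * y) = f x * y + x * f y) -> (forall i, P i -> f (F i) = 0) ->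
  f (\prod_(i <- r | P i) F i) = 0.
Proof.
move=> fM fF; elim/big_rec: _ => [|i x Pi fx]; first exact: derivation1.
by rewrite fM fF // fx mulr0 mul0r addr0.
Qed.

End Derivations.

(** These are the properties of variables and partial derivatives that the bracket computations use.
    [d_eventually0] makes the series defining a pivot a finite sum at each argument. Characteristic
    2 comes in when the truncated polynomials are shown to be an instance. *)
Record pivot_system (A : comPzRingType) (t : nat -> A) (d : nat -> A -> A) : Prop := PivotSystem {
  dD : forall i, {morph d i : x y / x + y};
  dM : forall i x y, d i (x * y) = d i x * y + x * d i y;
  dC : forall i j x, d i (d j x) = d j (d i x);
  dt : forall i j, d i (t j) = (i == j)%:R;
  d_eventually0 : forall x, exists N, forall i, (N <= i)%N -> d i x = 0 }.

Definition pivot_of (A : comPzRingType) (t : nat -> A) (d : nat -> A -> A) i x :=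
  \sum_(k \in [set: nat]) (\prod_(j < k) t (i.-1 + j)) * d (i + k) x.

(** The exponents form a sequence on all of [nat], so that one [a] serves every head [n] in an
    induction; only its first [n - 3] entries count. *)
Definition scaled_pivot (A : comPzRingType) (t : nat -> A) (d : nat -> A -> A) n
    (a : nat -> bool) x :=
  (\prod_(i < n - 3) t i ^+ a i) * pivot_of t d n x.

Section PivotCalculus.
Variables (A : comPzRingType) (t : nat -> A) (d : nat -> A -> A).
Hypothesis sys : pivot_system t d.
Local Notation v := (pivot_of t d).

Lemma pivot_finite N x : (forall i, (N <= i)%N -> d i x = 0) ->
  forall i, v i x = \sum_(k < N) (\prod_(j < k) t (i.-1 + j)) * d (i + k) x.
Proof.
move=> N0 i; rewrite (fsbig_ord _ _ (fun k => (\prod_(j < k) t (i.-1 + j)) * d (i + k) x)).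
symmetry; apply: fsbig_widen => // k /= [_ /negP]; rewrite -leqNgt => Nk.
by rewrite /preimage /= N0 ?mulr0 // (leq_trans Nk) ?leq_addl.
Qed.

(** A common cut-off for several arguments turns additivity, the Leibniz rule and commutation into
    termwise identities of finite sums. *)
Lemma pivot_uniform (s : seq A) : exists N, forall x, x \in s ->
  forall i, v i x = \sum_(k < N) (\prod_(j < k) t (i.-1 + j)) * d (i + k) x.
Proof.
suff [N N0] : exists N, forall x, x \in s -> forall i, (N <= i)%N -> d i x = 0.
  by exists N => x /N0; apply: pivot_finite.
elim: s => [|x s [N IH]]; first by exists 0%N.
have [M M0] := d_eventually0 sys x; exists (maxn M N) => y; rewrite inE.
by move=> /orP[/eqP-> i|ys i]; rewrite geq_max => /andP[/M0 + /(IH y)]; auto.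
Qed.

Lemma pivotD i : {morph v i : x y / x + y}.
Proof.
move=> x y; have [N E] := pivot_uniform [:: x; y; x + y].
rewrite !E ?inE ?eqxx ?orbT // -big_split /=.
by apply: eq_bigr => k _; rewrite (dD sys) mulrDr.
Qed.

Lemma pivotM i x y : v i (x * y) = v i x * y + x * v i y.
Proof.
have [N E] := pivot_uniform [:: x; y; x * y].
rewrite !E ?inE ?eqxx ?orbT // mulr_suml mulr_sumr -big_split /=.
by apply: eq_bigr => k _; rewrite (dM sys) mulrDr mulrA (mulrCA x).
Qed.

Lemma pivot_rec i x : v i.+1 x = d i.+1 x + t i * v i.+2 x.
Proof.
have [N N0] := d_eventually0 sys x.
(* The left series is cut at [N.+1] and the right one at [N]: once the term [k = 0] is split off on
   the left, both have the same length. *)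
have N0' j : (N.+1 <= j)%N -> d j x = 0 by move/ltnW/N0.
rewrite (pivot_finite N0' i.+1) (pivot_finite N0 i.+2).
rewrite big_ord_recl big_ord0 mul1r addn0; congr (_ + _).
rewrite mulr_sumr; apply: eq_bigr => k _.
rewrite big_ord_recl addn0 mulrA addnS; congr (_ * _ * _).
by apply: eq_bigr => j _; rewrite addnS.
Qed.

Lemma pivot_tlt i j : (j < i)%N -> v i (t j) = 0.
Proof.
move=> ji; apply: fsbig1 => k _.
by rewrite (dt sys) gtn_eqF ?mulr0 // (leq_trans ji) ?leq_addr.
Qed.

Lemma pivot_teq i : v i.+1 (t i.+1) = 1.
Proof. by rewrite pivot_rec (dt sys) eqxx pivot_tlt // mulr0 addr0. Qed.

(** The coefficients of v_j are products of t_{j-1}, t_j, ..., all killed by d_i when i < j-1, and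
    the partial derivatives commute. *)
Lemma partial_pivotC i j x : (i.+1 < j)%N -> d i (v j x) = v j (d i x).
Proof.
case: j => // j ij; have [N E] := pivot_uniform [:: x; d i x].
rewrite !E ?inE ?eqxx ?orbT // (big_morph _ (@dD _ _ _ sys i) (additive_eq0 (@dD _ _ _ sys i))).
apply: eq_bigr => k _; rewrite (dM sys) (dC sys) (derivation_prod0 _ (dM sys i)) ?mul0r ?add0r //.
by move=> l _; rewrite (dt sys) ltn_eqF // (leq_trans (ij : (i < j)%N)) ?leq_addr.
Qed.

(** Write v_{i+1} = d_{i+1} + t_i v_{i+2}. The second summand commutes with v_{i+2}, which kills
    t_i. In v_{i+2} = d_{i+2} + t_{i+1} v_{i+3}, d_{i+1} acts only on the factor t_{i+1}, which
    leaves v_{i+3}. *)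
Lemma bracket_pivot1 i x : v i.+1 (v i.+2 x) - v i.+2 (v i.+1 x) = v i.+3 x.
Proof.
rewrite [v i.+1 (v _ x)]pivot_rec [v i.+1 x]pivot_rec pivotD pivotM pivot_tlt //.
rewrite mul0r add0r opprD addrACA subrr addr0.
rewrite [v i.+2 x]pivot_rec (dD sys) (dM sys) (dt sys) eqxx mul1r.
rewrite [v i.+2 _]pivot_rec partial_pivotC //.
by rewrite (dC sys) opprD addrACA subrr add0r addrK.
Qed.

(** Here d_{i+1} commutes with v_{i+3}, so only t_i [v_{i+2}, v_{i+3}] survives. *)
Lemma bracket_pivot2 i x : v i.+1 (v i.+3 x) - v i.+3 (v i.+1 x) = t i * v i.+4 x.
Proof.
rewrite [v i.+1 (v _ x)]pivot_rec [v i.+1 x]pivot_rec pivotD pivotM.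
rewrite (@pivot_tlt i.+3 i) ?(leqW (leqnSn _)) //.
rewrite mul0r add0r opprD addrACA partial_pivotC // subrr add0r.
by rewrite -mulrBr bracket_pivot1.
Qed.

Lemma bracket_scaled_pivot i j w x : v i w = 0 ->
  v i (w * v j x) - w * v j (v i x) = w * (v i (v j x) - v j (v i x)).
Proof. by move=> iw; rewrite pivotM iw mul0r add0r mulrBr. Qed.

Lemma pivot_monomial0 m n (a : 'I_m -> bool) : (m <= n)%N ->
  v n (\prod_(i < m) t i ^+ a i) = 0.
Proof.
move=> mn; apply: derivation_prod0 => [|i _]; first exact: pivotM.
have vt : v n (t i) = 0 by rewrite pivot_tlt // (leq_trans (ltn_ord i)).
case: (a i); rewrite ?expr1 //.
exact: (derivation1 (@pivotM n)).
Qed.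

Lemma scaled_pivot_small n a : (n <= 3)%N -> scaled_pivot t d n a = v n.
Proof.
rewrite -subn_eq0 => /eqP n3; apply/funext => x.
by rewrite /scaled_pivot n3 big_ord0 mul1r.
Qed.

Lemma scaled_pivot_mem (P : set (A -> A)) :
    (forall D E, P D -> P E -> P (fun x => D (E x) - E (D x))) -> P (v 1) -> P (v 2) ->
  forall n a, P (scaled_pivot t d n.+1 a).
Proof.
move=> Pbr P1 P2; elim/ltn_ind => n IH a.
(* The zero exponent vector turns the induction hypothesis into membership of the bare pivots of
   smaller index. *)
have Pv m : (m < n)%N -> P (v m.+1).
  move=> mn; suff -> : v m.+1 = scaled_pivot t d m.+1 xpred0 by exact: IH.
  by apply/funext => x; rewrite /scaled_pivot big1 ?mul1r // => i _; rewrite expr0.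
case: n IH Pv => [|[|[|i]]] IH Pv.
- by rewrite scaled_pivot_small.
- by rewrite scaled_pivot_small.
- rewrite scaled_pivot_small //.
  have -> : v 3 = (fun x => v 1 (v 2 x) - v 2 (v 1 x)).
    by apply/funext => x; rewrite bracket_pivot1.
  exact: Pbr.
have small j : (i <= j)%N -> v j (\prod_(i0 < i) t i0 ^+ a i0) = 0.
  by move=> ij; apply: pivot_monomial0.
have i3 : (i.+3 - 3)%N = i by rewrite -addn3 addnK.
have := IH i.+2 (leqnn _) a; rewrite /scaled_pivot i3.
set w := fun x => _ => Pw.
(* The last exponent [a i] selects the partner of t^b v_{i+3}: bracketing with v_{i+2} leaves t_i
   out, bracketing with v_{i+1} brings it in. *)
case ai : (a i); last first.
  have := Pbr _ _ (Pv i.+1 (leqW (leqnn _))) Pw; congr P; apply/funext => x.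
  rewrite /w bracket_scaled_pivot ?(small _ (leqW (leqnSn i))) // bracket_pivot1.
  by rewrite (_ : i.+4 - 3 = i.+1)%N // big_ord_recr /= ai expr0 mulr1.
have := Pbr _ _ (Pv i (leqW (leqW (leqnn _)))) Pw; congr P; apply/funext => x.
rewrite /w bracket_scaled_pivot ?(small _ (leqnSn i)) // bracket_pivot2 mulrA.
by rewrite (_ : i.+4 - 3 = i.+1)%N // big_ord_recr /= ai expr1.
Qed.

End PivotCalculus.

(** * Linear independence of the scaled pivots *)

Section ScaledPivotsFree.
Variables (K : pzRingType) (A : comAlgType K) (t : nat -> A) (d : nat -> A -> A).
Hypothesis sys : pivot_system t d.
Hypothesis t_free : forall m (c : {ffun 'I_m -> bool} -> K),
  \sum_a c a *: \prod_(i < m) t i ^+ a i = 0 -> forall a, c a = 0.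

(** The system is triangular. At t_{n+1} the pivots of higher index vanish, v_{n+1} takes the value
    1, and the terms of lower index have zero coefficients by induction; what remains is a relation
    between squarefree monomials. *)
Lemma scaled_pivot_free M (c : forall n : 'I_M, {ffun 'I_(n.+1 - 3) -> bool} -> K) :
    (forall x, \sum_(n < M) \sum_a
       c n a *: ((\prod_(i < n.+1 - 3) t i ^+ a i) * pivot_of t d n.+1 x) = 0) ->
  forall n a, c n a = 0.
Proof.
move=> c0 n; have [k] := ubnP n; elim: k n => // k IH n /ltnSE nk a.
apply: t_free a; rewrite -[RHS](c0 (t n.+1)) (bigD1 n) //= [X in _ = _ + X]big1 ?addr0 => [|m mn].
  by apply: eq_bigr => a _; rewrite (pivot_teq sys) mulr1.
apply: big1 => a _; have [ltmn|ltnm|/val_inj eqmn] := ltngtP m n; last by rewrite eqmn eqxx in mn.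
  by rewrite IH ?scale0r // (leq_trans ltmn).
by rewrite (pivot_tlt sys) ?mulr0 ?scaler0 // ltnS.
Qed.

End ScaledPivotsFree.

(** * Truncated polynomials *)

Local Open Scope quotient_scope.

Section PolyPartial.
Variable K : fieldType.
Local Notation mon := (cmonom nat).
Local Notation P := (malg mon K).
Local Notation term c m := (mkmalgU m c).
Local Notation U := (@ucm nat).

Lemma divcm_eq (m m' : mon) i : (0 < m i)%N ->
  (divcm m (U i) == m') = (m == mulcm m' (U i)).
Proof.
move=> mi; apply/eqP/eqP => [<-|->]; apply/eqP/cmP => j.
  rewrite mulcmE divcmE ucmE; case: eqP => [<-|_]; first by rewrite subnK.
  by rewrite subn0 addn0.
by rewrite divcmE mulcmE addnK.
Qed.

(** The defining sum runs over the support of [p], which does not behave additively; linearity and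
    commutation are checked on this coefficient formula instead. *)
Lemma mcoeff_partial i (p : P) m :
  mcoeff m (poly_partial i p) = mcoeff (mulcm m (U i)) p *+ (m i).+1.
Proof.
rewrite /poly_partial raddf_sum /=.
pose m' := mulcm m (U i).
have m'i : m' i = (m i).+1 by rewrite mulcmE ucmE eqxx addn1.
have E n : mcoeff m (term (mcoeff n p *+ n i) (divcm n (U i)) : P) =
    (mcoeff n p *+ n i) *+ (n == m').
  (* If t_i does not occur in [n], the truncated quotient is meaningless, but its coefficient is
     0. *)
  rewrite mcoeffU; case: (posnP (n i)) => [->|ni]; first by rewrite mulr0n !mul0rn.
  by rewrite divcm_eq.
rewrite (eq_bigr _ (fun n _ => E n)) -/m'.
have [m'p|m'p] := boolP (m' \in msupp p); last first.
  rewrite (mcoeff_outdom m'p) mul0rn big1 // => n _; case: eqP => [->|//].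
  by rewrite (mcoeff_outdom m'p) !mul0rn.
rewrite (bigD1_seq m') ?fset_uniq //= eqxx m'i big1 ?addr0 // => n /negPf ->.
by rewrite mulr0n.
Qed.

Lemma poly_partialU i c (m : mon) :
  poly_partial i (term c m) = term (c *+ m i) (divcm m (U i)) :> P.
Proof.
rewrite /poly_partial msuppU; have [->|c0] := eqVneq c 0.
  by rewrite big_seq_fset0 mul0rn monalgU0.
by rewrite big_seq_fset1 mcoeffUU.
Qed.

Lemma poly_partial_eventually0 (p : P) : exists N, forall i, (N <= i)%N -> poly_partial i p = 0.
Proof.
exists (\max_(m <- msupp p) \max_(j <- finsupp (m : mon)) j.+1)%N => i Ni.
rewrite /poly_partial big1_seq // => m /= mp.
have [mi|] := boolP (i \in finsupp m); last first.
  by rewrite -cmE_eq0 => /eqP ->; rewrite monalgU0.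
suff : (i < i)%N by rewrite ltnn.
apply: leq_trans Ni; apply: (leq_trans _ (leq_bigmax_seq _ mp isT)).
exact: (leq_bigmax_seq _ mi isT).
Qed.

(* The proofs below generalize poly_partial, which unification would otherwise unfold. *)
Lemma poly_partial_linear i : linear (@poly_partial K i).
Proof.
move=> a p q; apply/malgP => m.
have cE := mcoeff_partial i; move: (@poly_partial K i) cE => f cE.
by rewrite !(cE, mcoeffD, mcoeffZ) mulrnDl mulrnAr.
Qed.

HB.instance Definition _ i := GRing.isLinear.Build K P P *:%R (@poly_partial K i)
  (poly_partial_linear i).

Lemma poly_partialC i j (p : P) :
  poly_partial i (poly_partial j p) = poly_partial j (poly_partial i p).
Proof.
apply/malgP => m; have [ci cj] := (mcoeff_partial i, mcoeff_partial j).
move: (@poly_partial K i) (@poly_partial K j) ci cj => f g ci cj.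
rewrite !(ci, cj) !mulcmE !ucmE eq_sym -!mulrnA [in RHS]mulnC.
have [->|_] := eqVneq i j; first by rewrite mulnC.
by rewrite !addn0 -!mulcmA (mulcmC (U i)).
Qed.

(** By [leibniz_sum] it suffices to treat two monomials, where the exponent of t_i in the product is
    the sum of the two exponents. *)
Lemma poly_partialM i (p q : P) :
  poly_partial i (p * q) = poly_partial i p * q + p * poly_partial i q.
Proof.
rewrite [p]monalgE [q]monalgE.
apply: leibniz_sum => [||m n]; [exact: linear0 | exact: linearD |].
move: (mcoeff m p) (mcoeff n q) => a b.
have mulUU (c d : K) k l : (term c k : P) * term d l = term (c * d) (mulcm k l).
  by rewrite malgM_def fgmulUU.
have partialU := poly_partialU i.
have monomD (c d : K) k : term (c + d) k = term c k + term d k :> P.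
  exact: monalgUD.
have monom0 k : term 0 k = 0 :> P by exact: monalgU0.
move: (@poly_partial K i) (@mkmalgU mon K) mulUU partialU monomD monom0.
move=> f u mulUU fu uD u0.
rewrite mulUU !fu !mulUU mulcmE mulrnDr uD mulrnAl mulrnAr.
congr (_ + _).
  case: (posnP (m i)) => [->|mi]; first by rewrite !mulr0n !u0.
  congr (u _ _); apply/eqP/cmP => j; rewrite !(mulcmE, divcmE) ucmE.
  by case: eqP => [<-|_]; rewrite ?subn0 // addnBAC.
case: (posnP (n i)) => [->|ni]; first by rewrite !mulr0n !u0.
congr (u _ _); apply/eqP/cmP => j; rewrite !(mulcmE, divcmE) ucmE.
by case: eqP => [<-|_]; rewrite ?subn0 // addnBA.
Qed.

Lemma poly_partial_var i j : poly_partial i (pvar K j) = (i == j)%:R.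
Proof.
apply: etrans (poly_partialU i 1 (U j)) _.
rewrite ucmE (eq_sym j); have [->|_] := eqVneq i j; last exact: monalgU0.
have -> // : divcm (U j) (U j) = onecm nat.
by apply/eqP/cmP => k; rewrite divcmE subnn onecmE.
Qed.

(** Characteristic 2 enters here: d_i(c t_j^2) = (d_i c) t_j^2 + 2 c t_j d_i(t_j), and the last term
    vanishes. Hence the partial derivatives descend to the quotient. *)
Lemma poly_partial_sq_ideal i (p : P) : 2%N \in [pchar K] ->
  p \in @sq_ideal K -> poly_partial i p \in @sq_ideal K.
Proof.
move=> char2 /asboolP [s ->]; apply/asboolP.
exists [seq (poly_partial i c.1, c.2) | c <- s].
rewrite linear_sum big_map; apply: eq_bigr => c _ /=.
rewrite poly_partialM; set f := poly_partial i.
have -> : f (pvar K c.2 ^+ 2) = 0; last by rewrite mulr0 addr0.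
rewrite expr2 /f poly_partialM mulrC; apply: addrr_pchar2.
by rewrite pchar_lalg.
Qed.

Local Notation T := (trunc_poly K).
Hypothesis char2 : 2%N \in [pchar K].

Lemma partial_pi i (p : P) : partial K i (\pi_T p) = \pi_T (poly_partial i p).
Proof.
apply/eqP; rewrite -Quotient.idealrBE -linearB; apply: poly_partial_sq_ideal => //.
by rewrite Quotient.idealrBE reprK.
Qed.

Lemma pi_scale a (p : P) : \pi_T (a *: p) = a *: \pi_T p.
Proof. by rewrite -scale_quot_pi. Qed.

Lemma pi_add (p q : P) : \pi_T (p + q) = \pi_T p + \pi_T q.
Proof. exact: pi_addr. Qed.

Lemma pi_mul (p q : P) : \pi_T (p * q) = \pi_T p * \pi_T q.
Proof. exact: pi_mulr. Qed.

Lemma pi_linear : linear (fun p : P => \pi_T p).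
Proof. by move=> a p q; rewrite pi_add pi_scale. Qed.

Lemma partial_linear i : linear (partial K i).
Proof.
exact: (linear_descent (@reprK _ T) pi_linear (@poly_partial_linear i) (partial_pi i)).
Qed.

Lemma partialM i x y : partial K i (x * y) = partial K i x * y + x * partial K i y.
Proof.
exact: (leibniz_descent (@reprK _ T) pi_add pi_mul (@poly_partialM i) (partial_pi i)).
Qed.

Lemma partialC i j x : partial K i (partial K j x) = partial K j (partial K i x).
Proof. by rewrite -[x]reprK !partial_pi poly_partialC. Qed.

Lemma partial_tvar i j : partial K i (tvar K j) = (i == j)%:R.
Proof. by rewrite partial_pi poly_partial_var rmorph_nat. Qed.

Lemma partial_eventually0 x : exists N, forall i, (N <= i)%N -> partial K i x = 0.
Proof.
have [N N0] := poly_partial_eventually0 (repr x).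
by exists N => i /N0; rewrite /partial => ->; rewrite rmorph0.
Qed.

Lemma trunc_pivot_system : pivot_system (tvar K) (partial K).
Proof.
split; [|exact: partialM|exact: partialC|exact: partial_tvar|exact: partial_eventually0].
by move=> i x y; have := partial_linear i 1 x y; move: (partial K i) => f; rewrite !scale1r.
Qed.

End PolyPartial.

Lemma morph_lincomb_prod (K : pzRingType) (A B : comAlgType K) (pi : A -> B)
    (n : nat) (I : finType) (c : I -> K) (a : I -> 'I_n -> bool) (z : 'I_n -> A) :
    {morph pi : x y / x + y} -> {morph pi : x y / x * y} -> pi 0 = 0 -> pi 1 = 1 ->
    (forall k x, pi (k *: x) = k *: pi x) ->
  pi (\sum_b c b *: \prod_(i < n) z i ^+ a b i) = \sum_b c b *: \prod_(i < n) pi (z i) ^+ a b i.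
Proof.
move=> piD piM pi0 pi1 piZ; rewrite (big_morph _ piD pi0); apply: eq_bigr => b _.
rewrite piZ (big_morph _ piM pi1); congr (_ *: _); apply: eq_bigr => i _.
by case: (a b i); rewrite ?expr1 ?expr0.
Qed.

(** * Independence of the squarefree monomials in the truncated ring *)

Section SquarefreeMonomials.
Variable K : fieldType.
Local Notation mon := (cmonom nat).
Local Notation P := (malg mon K).
Local Notation term c m := (mkmalgU m c).
Local Notation T := (trunc_poly K).

(** Each monomial of an element of the ideal is divisible by some t_j^2, so it has an exponent of at
    least 2. *)
Lemma mcoeff_sq_ideal (p : P) (m : mon) :
  p \in @sq_ideal K -> (forall j, (m j <= 1)%N) -> mcoeff m p = 0.
Proof.
move=> /asboolP [s ->] m1; rewrite raddf_sum big1 // => c _ /=.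
have -> : pvar K c.2 ^+ 2 = term 1 (mulcm (ucm c.2) (ucm c.2)).
  by rewrite expr2 malgM_def fgmulUU mulr1.
rewrite malgM_def fgmulgU raddf_sum big1 // => n _ /=.
rewrite mcoeffU; case: eqP => // e; have := m1 c.2.
by rewrite -e /= !mulcmE !cmUU addn2.
Qed.

Definition sqfree_mon n (a : 'I_n -> bool) : mon :=
  \big[@mulcm nat/onecm nat]_(i < n) (if a i then ucm (i : nat) else onecm nat).

Lemma sqfree_monE n (a : 'I_n -> bool) j :
  sqfree_mon a j = (\sum_(i < n) a i * (j == i))%N.
Proof.
rewrite /sqfree_mon (big_morph (fun m : mon => m j) (fun m1 m2 => mulcmE m1 m2 j) (onecmE j)).
by apply: eq_bigr => i _; case: (a i); rewrite ?ucmE ?onecmE ?mul1n // eq_sym.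
Qed.

Lemma sqfree_mon_ord n (a : 'I_n -> bool) (i : 'I_n) : sqfree_mon a i = a i.
Proof.
rewrite sqfree_monE (bigD1 i) //= eqxx muln1 big1 ?addn0 // => k ki.
by rewrite (eq_sym (nat_of_ord i)) (negPf (ki : (k : nat) != i)) muln0.
Qed.

Lemma sqfree_mon_le1 n (a : 'I_n -> bool) j : (sqfree_mon a j <= 1)%N.
Proof.
have [jn|nj] := ltnP j n; first by rewrite (sqfree_mon_ord a (Ordinal jn)) leq_b1.
rewrite sqfree_monE big1 // => i _.
by rewrite gtn_eqF ?muln0 // (leq_trans _ nj).
Qed.

Lemma sqfree_mon_inj n : injective (fun a : {ffun 'I_n -> bool} => sqfree_mon a).
Proof.
move=> a b ab; apply/ffunP => i; have := sqfree_mon_ord a i.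
by rewrite ab sqfree_mon_ord; case: (a i); case: (b i).
Qed.

Lemma prod_pvar n (a : 'I_n -> bool) :
  \prod_(i < n) pvar K i ^+ a i = term 1 (sqfree_mon a).
Proof.
rewrite /sqfree_mon (big_morph (fun m : mon => term 1 m : P)
  (id1 := 1) (op1 := *%R)) => [|m1 m2|//]; last by rewrite malgM_def fgmulUU mulr1.
by apply: eq_bigr => i _; case: (a i).
Qed.

(** A relation lifts to a polynomial in the ideal of squares. Its coefficient at the monomial of [a]
    is [c a], as distinct exponent vectors give distinct monomials, and this coefficient is 0. *)
Lemma tvar_free n (c : {ffun 'I_n -> bool} -> K) :
  \sum_a c a *: \prod_(i < n) tvar K i ^+ a i = 0 -> forall a, c a = 0.
Proof.
move=> c0 a.
pose p : P := \sum_(b : {ffun 'I_n -> bool}) c b *: \prod_(i < n) pvar K i ^+ b i.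
have p_sq : p \in @sq_ideal K.
  rewrite -[p]subr0 Quotient.idealrBE; apply/eqP.
  apply: etrans (morph_lincomb_prod c _ _ (@pi_add K) (@pi_mul K) _ _ (@pi_scale K)) _.
  - exact: pi_zeror.
  - exact: pi_oner.
  - by apply: etrans c0 _; apply: esym; exact: pi_zeror.
have := mcoeff_sq_ideal p_sq (sqfree_mon_le1 a).
have -> : p = \sum_(b : {ffun 'I_n -> bool}) term (c b) (sqfree_mon b).
  apply: eq_bigr => b _; rewrite prod_pvar; apply/malgP => m.
  apply: etrans (mcoeffZ _ _ _) _; apply: etrans _ (esym (mcoeffU _ _ _)).
  by apply: etrans (congr1 ( *%R (c b)) (mcoeffU _ _ _)) _; rewrite mulr_natr.
have coefE (b : {ffun 'I_n -> bool}) :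
    mcoeff (sqfree_mon a) (term (c b) (sqfree_mon b)) = c b *+ (b == a).
  by apply: etrans (mcoeffU _ _ _) _; rewrite (inj_eq (@sqfree_mon_inj n)).
rewrite raddf_sum (eq_bigr _ (fun b _ => coefE b)).
by rewrite (bigD1 a) //= eqxx big1 ?addr0 // => b /negPf ->.
Qed.

End SquarefreeMonomials.

(** * Dimension and the weight growth function *)

Section Dimension.
Variables (K : fieldType) (V : lmodType K).

(** Expanding [b] in [b'] and back gives transition matrices with product 1, of inner size [d'];
    this forces [d <= d']. *)
Lemma basis_size_le d d' (A : set V) (b : 'I_d -> V) (b' : 'I_d' -> V) :
  is_basis A b -> is_basis A b' -> (d <= d')%N.
Proof.
move=> [Ab free_b gen_b] [Ab' _ gen_b'].
have [M bM] := choice (fun i => gen_b' _ (Ab i)).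
have [N bN] := choice (fun j => gen_b _ (Ab' j)).
suff : (\matrix_(i, j) M i j) *m (\matrix_(j, i) N j i) = 1%:M by exact: mulmx1_min.
apply/matrixP => i k; rewrite !mxE; apply/eqP; rewrite -subr_eq0; apply/eqP.
apply: (free_b (fun k =>
  \sum_j (\matrix_(i, j) M i j) i j * (\matrix_(j, i) N j i) j k - (i == k)%:R)).
under eq_bigr do rewrite scalerBl scaler_suml.
rewrite sumrB exchange_big /= [X in _ - X](bigD1 i) //= eqxx scale1r.
rewrite [X in _ - (_ + X)]big1 ?addr0 => [|j ji]; last by rewrite eq_sym (negPf ji) scale0r.
rewrite [X in _ - X]bM; apply/eqP; rewrite subr_eq0; apply/eqP; apply: eq_bigr => j _.
rewrite [in RHS]bN scaler_sumr; apply: eq_bigr => l _.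
by rewrite !mxE scalerA.
Qed.

Lemma dimension_basis d (A : set V) (b : 'I_d -> V) : is_basis A b -> dimension A = d.
Proof.
move=> Ab; apply: xget_unique; first by exists b.
by move=> d' [b' Ab']; apply/eqP; rewrite eqn_leq !(basis_size_le Ab Ab', basis_size_le Ab' Ab).
Qed.

Lemma dimension_span (I : finType) (F : I -> V) (P : {pred I}) :
    (forall c : I -> K, \sum_i c i *: F i = 0 -> forall i, c i = 0) ->
  dimension (lin_span [set F u | u in [set` P]]) = #|P|.
Proof.
move=> freeF; set S := [set _ | _ in _].
have S_sub : S `<=` lin_span S by exact: sub_gen_smallest.
apply: (@dimension_basis _ _ (fun i : 'I_#|P| => F (enum_val i))); split.
- by move=> i; apply: S_sub; exists (enum_val i); rewrite //= enum_valP.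
- move=> c c0 i.
  (* The coefficients are extended by zero from [P] to [I]: the sum has one term if [u] is in [P]
     and is empty otherwise. *)
  pose c' u := \sum_(j | enum_val j == u) c j.
  have -> : c i = c' (enum_val i).
    by rewrite /c' (big_pred1 i) // => j; rewrite (inj_eq enum_val_inj).
  apply: freeF; rewrite -[RHS]c0 (partition_big (@enum_val _ P) xpredT) //=.
  by apply: eq_bigr => u _; rewrite scaler_suml; apply: eq_bigr => j /eqP ->.
apply: (smallest_sub (X := [set v | exists c : 'I_#|P| -> K, v = \sum_i c i *: F (enum_val i)])).
  split; first by exists (fun=> 0); rewrite big1 // => i _; rewrite scale0r.
  move=> a _ _ [c ->] [c' ->]; exists (fun i => a * c i + c' i).
  rewrite scaler_sumr -big_split; apply: eq_bigr => i _ /=.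
  by rewrite scalerDl scalerA.
move=> _ [u Pu <-]; exists (fun i => (i == enum_rank_in Pu u)%:R).
rewrite (bigD1 (enum_rank_in Pu u)) //= eqxx scale1r enum_rankK_in // big1 ?addr0 //.
by move=> i /negPf ->; rewrite scale0r.
Qed.

End Dimension.

(** * The weight growth function as a number of monomials *)

Section WeightGrowth.
Variable K : fieldType.
Hypothesis char2 : 2%N \in [pchar K].
Local Notation T := (trunc_poly K).

Lemma fib_monomialE n (alpha : {ffun 'I_(n - 3) -> bool}) :
  fib_monomial (K := K) alpha =
  scaled_pivot (tvar K) (partial K) n (fun i => odflt false (omap alpha (insub i))).
Proof.
apply/funext => x; rewrite /fib_monomial /scaled_pivot; congr (_ * _).
by apply: eq_bigr => i _; rewrite valK.
Qed.

Lemma fib_monomial_mem n (alpha : {ffun 'I_(n - 3) -> bool}) :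
  (0 < n)%N -> fibonacci_lie K (fib_monomial alpha).
Proof.
case: n alpha => // n alpha _ A [[_ _ Abr] Apiv]; rewrite fib_monomialE.
apply: (scaled_pivot_mem (trunc_pivot_system char2)); first exact: Abr.
  by apply: Apiv; left.
by apply: Apiv; right.
Qed.

Lemma fib_monomial_free M (c : {n : 'I_M & {ffun 'I_(n.+1 - 3) -> bool}} -> K) :
  \sum_u c u *: fib_monomial (K := K) (tagged u) = 0 -> forall u, c u = 0.
Proof.
move=> c0 [n a].
apply: (scaled_pivot_free (trunc_pivot_system char2) (@tvar_free K)
  (c := fun n a => c (Tagged _ a))) => x.
rewrite sig_big_dep /=.
have : (\sum_u c u *: fib_monomial (K := K) (tagged u)) x = 0 by rewrite c0.
by rewrite fct_sumE; apply: etrans; apply: eq_bigr => -[m b] _.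
Qed.

Variable R : realType.

(** The bound [M] on the heads makes the index type of the monomials finite; an index [n < M] stands
    for the head v_{n+1}. *)
Lemma weight_growthE (x : R) M :
  (forall n (alpha : {ffun 'I_(n - 3) -> bool}), weight R alpha <= x -> (n <= M)%N) ->
  weight_growth K x =
    (\sum_(n < M) #|[pred a : {ffun 'I_(n.+1 - 3) -> bool} | (weight R a <= x)%R]|)%N.
Proof.
move=> boundM.
pose P := [pred u : {n : 'I_M & {ffun 'I_(n.+1 - 3) -> bool}} | weight R (tagged u) <= x].
have basisE : @basis_upto K R x = [set fib_monomial (K := K) (tagged u) | u in [set` P]].
  apply/seteqP; split=> [_ [n [a [n0 wa ->]]]|_ [[n a] /= + <-]].
    case: n n0 a wa => // n _ a wa.
    pose B (n : 'I_M) := {ffun 'I_(n.+1 - 3) -> bool}.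
    by exists (Tagged B (a : B (Ordinal (boundM _ _ wa)))); rewrite //= inE.
  by rewrite inE => wa; exists n.+1, a.
have -> : weight_growth K x = #|P|.
  rewrite /weight_growth (_ : _ `&` _ = lin_span (@basis_upto K R x)).
    rewrite basisE; apply: dimension_span => c c0; exact: fib_monomial_free c0.
  apply/seteqP; split=> [w []//|w spw]; split=> // A /= Alie.
  apply: spw; split; first by case: Alie => -[].
  by move=> _ [n [a [n0 _ ->]]]; apply: fib_monomial_mem n0 _ Alie.
rewrite -sum1_card; under [RHS]eq_bigr do rewrite -sum1_card.
by rewrite sig_big_dep; apply: eq_bigl => -[n a].
Qed.

End WeightGrowth.

(** * Counting monomials by weight *)

Section Golden.
Variable R : realType.
Local Notation phi := (golden R).

Lemma golden_sqr : phi ^+ 2 = phi + 1.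
Proof.
have s5 : Num.sqrt (5 : R) ^+ 2 = 5 by rewrite sqr_sqrtr.
rewrite /golden; set s := Num.sqrt 5 in s5 *.
have -> : ((1 + s) / 2) ^+ 2 = (1 + 2 * s + s ^+ 2) / 4 by field.
by rewrite s5; field.
Qed.

Lemma golden_gt1 : 1 < phi.
Proof.
have s5 : 1 < Num.sqrt (5 : R) by rewrite -[X in X < _]sqrtr1 ltr_sqrt ?ltr1n.
rewrite /golden; lra.
Qed.

Lemma golden_lt2 : phi < 2.
Proof. by have := golden_sqr; have := golden_gt1; nra. Qed.

Lemma golden_gt0 : 0 < phi.
Proof. exact: lt_trans ltr01 golden_gt1. Qed.

Lemma golden_expSS m : phi ^+ m.+2 = phi ^+ m.+1 + phi ^+ m.
Proof. by rewrite -addn2 exprD golden_sqr mulrDr mulr1 -exprSr. Qed.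

Lemma sum_golden_exp m : \sum_(i < m) phi ^+ i = phi ^+ m.+1 - phi.
Proof.
elim: m => [|m IH]; first by rewrite big_ord0 expr1 subrr.
by rewrite big_ord_recr /= IH golden_expSS addrAC.
Qed.

Lemma ler_golden_exp m n : (m <= n)%N -> phi ^+ m <= phi ^+ n.
Proof. by move=> mn; rewrite ler_eXn2l // golden_gt1. Qed.

Lemma golden_exp_unbounded (C : R) : exists m0, forall m, (m0 <= m)%N -> C <= phi ^+ m.
Proof.
(* Since phi^2 = phi + 1 >= 2, the power phi^(2b) is at least 2^b, which exceeds [C] for b =
   [Num.bound C]. *)
exists (2 * Num.bound C)%N => m /ler_golden_exp; apply: le_trans.
rewrite exprM golden_sqr; apply: le_trans (ltW (upper_nthrootP (leqnn _))) _.
by rewrite lerXn2r ?nnegrE //; have := golden_gt1; lra.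
Qed.

Lemma weight_le n (alpha : {ffun 'I_(n - 3) -> bool}) : weight R alpha <= phi ^+ n.
Proof.
rewrite /weight gerBl sumr_ge0 // => i _.
by rewrite mulr_ge0 ?exprn_ge0 // ltW // golden_gt0.
Qed.

(* phi^0 + ... + phi^(k-1) = phi^(k+1) - phi and phi^(k+3) - phi^(k+1) = phi^(k+2). *)
Lemma weight_compl k (alpha : {ffun 'I_(k.+3 - 3) -> bool}) :
  weight R alpha = phi ^+ k.+2 + phi + \sum_(i < k.+3 - 3) (~~ alpha i)%:R * phi ^+ i.
Proof.
have : \sum_(i < k.+3 - 3) (alpha i)%:R * phi ^+ i +
       \sum_(i < k.+3 - 3) (~~ alpha i)%:R * phi ^+ i = phi ^+ k.+1 - phi.
  rewrite -big_split /= -sum_golden_exp -[in RHS](addnK 3 k) addn3.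
  by apply: eq_bigr => i _; case: (alpha i); rewrite mul1r mul0r ?addr0 ?add0r.
by rewrite /weight (golden_expSS k.+1); lra.
Qed.

(** For n >= 3 this drops nonnegative terms from [weight_compl]. It lets a bound on the weight bound
    the head. *)
Lemma le_weight n (alpha : {ffun 'I_(n - 3) -> bool}) : phi ^+ n.-1 <= weight R alpha.
Proof.
case: n alpha => [|[|[|n]]] alpha; rewrite ?weight_compl.
- by rewrite /weight big_ord0 subr0.
- by rewrite /weight big_ord0 subr0 expr0 expr1 ltW // golden_gt1.
- by rewrite /weight big_ord0 subr0 ler_golden_exp.
rewrite -addrA lerDl addr_ge0 ?(ltW golden_gt0) // sumr_ge0 // => i _.
by rewrite mulr_ge0 ?exprn_ge0 // ltW // golden_gt0.
Qed.

(* The variables missing from a have total weight below phi^l, so a contains t_l, t_{l+1}, ... *)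
Lemma level_card_le k l (x : R) : x <= phi ^+ k.+2 + phi ^+ l ->
  (#|[pred a : {ffun 'I_(k.+3 - 3) -> bool} | (weight R a <= x)%R]| <= 2 ^ l)%N.
Proof.
move=> xl; pose D := [pred i : 'I_(k.+3 - 3) | (i < l)%N].
have Dl : (#|D| <= l)%N.
  rewrite cardE -(size_map val) -[leqRHS](size_iota 0); apply: uniq_leq_size.
    by rewrite map_inj_uniq ?enum_uniq //; exact: val_inj.
  by move=> _ /mapP[i + ->]; rewrite mem_enum mem_iota.
apply: (@leq_trans (2 ^ #|D|)); last by rewrite leq_exp2l.
(* These are the exponent vectors equal to [true] outside [D]. *)
have <- : #|pffun_on true D predT| = (2 ^ #|D|)%N by rewrite card_pffun_on card_bool.
apply/subset_leq_card/fintype.subsetP => a; rewrite inE => wa.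
apply/pffun_onP; split => //; apply/fintype.subsetP => i.
rewrite !inE => ai; rewrite ltnNge; apply/negP => li.
suff : phi ^+ l <= \sum_(j < k.+3 - 3) (~~ a j)%:R * phi ^+ j.
  by move: wa xl golden_gt0; rewrite weight_compl; lra.
apply: le_trans (ler_golden_exp li) _.
rewrite (bigD1 i) //= (_ : ~~ a i) ?mul1r ?lerDl; last by case: (a i) ai.
by apply: sumr_ge0 => j _; rewrite mulr_ge0 ?exprn_ge0 // ltW // golden_gt0.
Qed.

(** The left side is the number of monomials with heads v_1, ..., v_{k+2}: one each for v_1 and v_2,
    then 1 + 2 + ... + 2^(k-1). *)
Lemma sum_levels k : (\sum_(n < k.+2) 2 ^ (n.+1 - 3) = 2 ^ k + 1)%N.
Proof.
elim: k => [|k IH]; first by rewrite !big_ord_recr big_ord0.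
by rewrite big_ord_recr /= IH (_ : k.+3 - 3 = k)%N ?expnS; lia.
Qed.

(** * Bounds for the counting function near powers of the golden ratio *)

Section Growth.
Variables (N : R -> nat).
Hypothesis NE : forall (x : R) M,
  (forall n (alpha : {ffun 'I_(n - 3) -> bool}), weight R alpha <= x -> (n <= M)%N) ->
  N x = (\sum_(n < M) #|[pred a : {ffun 'I_(n.+1 - 3) -> bool} | (weight R a <= x)%R]|)%N.

Lemma growth_levels (x : R) M : x < phi ^+ M ->
  N x = (\sum_(n < M) #|[pred a : {ffun 'I_(n.+1 - 3) -> bool} | (weight R a <= x)%R]|)%N.
Proof.
move=> xM; apply: NE => n a wa.
have : phi ^+ n.-1 < phi ^+ M by apply: le_lt_trans (le_trans (le_weight a) wa) xM.
by rewrite ltr_eXn2l ?golden_gt1 //; lia.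
Qed.

Lemma growth_ge k (x : R) : phi ^+ k.+2 <= x -> (2 ^ k <= N x)%N.
Proof.
move=> kx; have [M0 M0x] := golden_exp_unbounded (x + 1).
have xM : x < phi ^+ M0 by have := M0x _ (leqnn _); lra.
have kM : (k.+2 <= M0)%N.
  by rewrite ltnW // -(ltr_eXn2l golden_gt1); apply: le_lt_trans kx xM.
rewrite (growth_levels xM); apply: leq_trans (_ : 2 ^ k + 1 <= _)%N; first lia.
rewrite -sum_levels (big_ord_widen _ (fun n => 2 ^ (n.+1 - 3))%N kM) big_mkcond /=.
apply: leq_sum => n _; case: ifP => // nk.
rewrite (eq_card (B := predT)) ?card_ffun ?card_bool ?card_ord // => a.
rewrite !inE; apply: le_trans (weight_le a) (le_trans _ kx).
exact: ler_golden_exp.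
Qed.

(** As l <= k, [x] stays below phi^(k+3), so no head exceeds k+3. The heads up to k+2 contribute at
    most 2^k + 1, and the head k+3 at most 2^l. *)
Lemma growth_le k l (x : R) : (l <= k)%N -> x <= phi ^+ k.+2 + phi ^+ l ->
  (N x <= 2 ^ k + 1 + 2 ^ l)%N.
Proof.
move=> lk xl; have xM : x < phi ^+ k.+3.
  apply: le_lt_trans xl _; rewrite [ltRHS]golden_expSS ltrD2l.
  by rewrite ltr_eXn2l ?golden_gt1.
rewrite (growth_levels xM) big_ord_recr /= leq_add //; last exact: level_card_le.
rewrite -sum_levels; apply: leq_sum => n _.
by apply: leq_trans (max_card _) _; rewrite card_ffun card_bool card_ord.
Qed.

End Growth.

End Golden.

(** * Two subsequences with different limits *)

Section Limit.
Variable R : realType.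
Local Notation phi := (golden R).
Local Notation theta := (ln 2 / ln (golden R) : R).

Lemma ln_golden_gt0 : 0 < ln phi.
Proof. exact: ln_gt0 (golden_gt1 R). Qed.

(** The reason is phi < 2 <= phi^2. Consequently u^theta lies between u and u^2 for u >= 1, which
    keeps the later estimates polynomial. *)
Lemma theta_bounds : 1 <= theta <= 2.
Proof.
have l0 := ln_golden_gt0; have p0 := golden_gt0 R.
apply/andP; split.
  by rewrite ler_pdivlMr // mul1r ler_ln ?posrE // ltW // golden_lt2.
rewrite ler_pdivrMr // mulr_natl -lnXn // ler_ln ?posrE ?exprn_gt0 //.
by rewrite golden_sqr; have := golden_gt1 R; lra.
Qed.

Lemma golden_exp_powR m : (phi ^+ m) `^ theta = 2 ^+ m.
Proof.
have p0 := golden_gt0 R.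
rewrite -powR_mulrn ?(ltW p0) // powRAC powR_mulrn ?powR_ge0 //; congr (_ ^+ m).
by rewrite /powR gt_eqF // divfK ?gt_eqF ?ln_golden_gt0 // lnK // posrE.
Qed.

Lemma powR_theta_ge m (x : R) : phi ^+ m <= x -> 2 ^+ m * (x / phi ^+ m) <= x `^ theta.
Proof.
move=> mx; have pm : 0 < phi ^+ m by rewrite exprn_gt0 ?golden_gt0.
have u1 : 1 <= x / phi ^+ m by rewrite ler_pdivlMr // mul1r.
rewrite -[in leRHS](divfK (lt0r_neq0 pm) x) mulrC powRM ?(ltW pm) ?(le_trans ler01) //.
rewrite golden_exp_powR ler_pM2r ?exprn_gt0 //.
by apply: le1r_powR => //; case/andP: theta_bounds.
Qed.

Lemma powR_theta_le m (x : R) : phi ^+ m <= x -> x `^ theta <= 2 ^+ m * (x / phi ^+ m) ^+ 2.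
Proof.
move=> mx; have pm : 0 < phi ^+ m by rewrite exprn_gt0 ?golden_gt0.
have u1 : 1 <= x / phi ^+ m by rewrite ler_pdivlMr // mul1r.
rewrite -[in leLHS](divfK (lt0r_neq0 pm) x) mulrC powRM ?(ltW pm) ?(le_trans ler01) //.
rewrite golden_exp_powR ler_pM2l ?exprn_gt0 // -[leRHS]powR_mulrn ?(le_trans ler01) //.
by apply: ler_powR => //; case/andP: theta_bounds.
Qed.

Lemma golden_exp10 : phi ^+ 10 = 55 * phi + 34.
Proof. by rewrite !golden_expSS expr1 expr0; ring. Qed.

Lemma ler_golden_two m : phi ^+ m <= 2 ^+ m.
Proof. by rewrite lerXn2r ?nnegrE ?(ltW (golden_gt0 R)) // ltW // golden_lt2. Qed.

(* The constant 1/4 - 5/10^4 lies above the limiting ratio (1/4 + 2^-10) / (1 + phi^-10), as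
   phi^10 < 144. *)
Lemma ratio_upper (D L a p N T : R) : 100 * 100 <= L -> L <= D -> L <= 144 * a -> L + a <= p + 1 ->
  N <= D / 4 + 1 + D / (32 * 32) -> D * (p / L) <= T -> N <= (1 / 4 - 5 / (100 * 100)) * T.
Proof.
move=> L4 LD La Lap ND DT; have L0 : 0 < L by apply: lt_le_trans L4; rewrite mulr_gt0 ?ltr0n.
(* From p >= L + a - 1, the quotient is at least 1 + 1/144 - 1/10^4. *)
have u1 : 1 + 1 / 150 <= p / L by rewrite ler_pdivlMr //; lra.
have : D * (1 + 1 / 150) <= D * (p / L) by rewrite ler_pM2l // (lt_le_trans L0).
(* As 1 <= D/10^4, the numerical fact behind this is 1/4 + 1/10^4 + 1/2^10 <= (1/4 - 5/10^4)(1 +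
   1/150). *)
by move: (p / L) DT {u1} => u; lra.
Qed.

(** Rounding [L] up to [q] changes it by a factor of at most 1 + 1/10^4, and (1/4 - 1/10^4)(1 +
    1/10^4)^2 <= 1/4. *)
Lemma ratio_lower (D L q N T : R) : 100 * 100 <= L -> L <= D -> L <= q -> q <= L + 1 ->
  D / 4 <= N -> T <= D * (q / L) ^+ 2 -> (1 / 4 - 1 / (100 * 100)) * T <= N.
Proof.
move=> L4 LD Lq qL ND TD; have L0 : 0 < L by apply: lt_le_trans L4; rewrite mulr_gt0 ?ltr0n.
have u1 : q / L <= 1 + 1 / (100 * 100) by rewrite ler_pdivrMr //; lra.
have u0 : 0 <= q / L by rewrite divr_ge0 ?(ltW L0) // (le_trans (ltW L0)).
have : D * (q / L) ^+ 2 <= D * (1 + 1 / (100 * 100)) ^+ 2.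
  by rewrite (ler_pM2l (lt_le_trans L0 LD)); apply: lerXn2r u1; rewrite nnegrE // (le_trans u0).
by move: (q / L) TD {u0 u1} => u; lra.
Qed.

Lemma no_growth_limit (N : R -> nat) :
    (forall k x, phi ^+ k.+2 <= x -> (2 ^ k <= N x)%N) ->
    (forall k l x, (l <= k)%N -> x <= phi ^+ k.+2 + phi ^+ l ->
       (N x <= 2 ^ k + 1 + 2 ^ l)%N) ->
  ~ exists l : R, (N n%:R)%:R / n%:R `^ theta @[n --> \oo] --> l.
Proof.
move=> Nge Nle [l /cvgrPdist_lt/(_ (2 / (100 * 100)))].
case; first by rewrite divr_gt0 ?mulr_gt0 ?ltr0n.
move=> n0 _ n0P; have [m0 m0P] := golden_exp_unbounded (100 * 100 + n0%:R : R).
(* This makes k + 2 = m0 + 10, so the perturbation phi^m0 sits ten levels below phi^(k+2); [D] is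
   the theta-th power of phi^(k+2). *)
pose k := (m0 + 8)%N; pose D : R := 2 ^+ k.+2.
have kD : (2 ^ k)%:R = D / 4 :> R.
  by rewrite natrX /D !exprS; move: (2 ^+ k : R) => z; field.
have kE : k.+2 = (10 + m0)%N by rewrite /k; lia.
have m0D : (2 ^ m0)%:R = D / (32 * 32) :> R.
  by rewrite natrX /D kE exprD; move: (2 ^+ m0 : R) => z; field.
have LD : phi ^+ k.+2 <= D by exact: ler_golden_two.
have La : phi ^+ k.+2 <= 144 * phi ^+ m0.
  rewrite kE exprD golden_exp10 ler_pM2r ?exprn_gt0 ?golden_gt0 //.
  by move: (golden_lt2 R); lra.
have LC : 100 * 100 + n0%:R <= phi ^+ k.+2 by apply: m0P; rewrite /k; lia.
have a1 : 1 <= phi ^+ m0 by rewrite exprn_ege1 // ltW // golden_gt1.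
have DE : D = 2 ^+ k.+2 by [].
move: (phi ^+ k.+2) (phi ^+ m0) (Nge k) (Nle k m0) (@powR_theta_ge k.+2) (@powR_theta_le k.+2)
  LD La LC a1 => L a NgeL NleL theta_ge theta_le LD La LC a1.
rewrite -DE in theta_ge theta_le.
move: D {DE} kD m0D LD theta_ge theta_le => D kD m0D LD theta_ge theta_le.
have L4 : 100 * 100 <= L by apply: le_trans LC; rewrite lerDl.
have Ln0 : n0%:R <= L by apply: le_trans LC; rewrite lerDr.
have L0 : 0 <= L by apply: le_trans L4; rewrite mulr_ge0 ?ler0n.
have near_l (n : nat) : L <= n%:R -> `|l - (N n%:R)%:R / n%:R `^ theta| < 2 / (100 * 100).
  by move=> Ln; apply: n0P; rewrite /= -(ler_nat R) (le_trans Ln0).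
have theta_gt0 (n : nat) : L <= n%:R -> 0 < n%:R `^ theta.
  by move=> Ln; rewrite powR_gt0 // (lt_le_trans _ Ln) // (lt_le_trans _ L4) // mulr_gt0 ?ltr0n.
(* Rounding up keeps [q] above [L], as the lower bound on [N] requires; rounding down keeps [p]
   below [L + a], as the upper bound requires. *)
pose q := (Num.trunc L).+1; pose p := Num.trunc (L + a).
have /andP[qL Lq] := trunc_itv L0.
have /andP[pLa Lap] := trunc_itv (addr_ge0 L0 (le_trans ler01 a1)).
rewrite -/q -/p -natr1 in Lq Lap.
have Lp : L <= p%:R by rewrite -(lerD2r 1) (le_trans _ (ltW Lap)) // lerD2l.
have Np : (N p%:R)%:R <= (1 / 4 - 5 / (100 * 100)) * p%:R `^ theta.
  apply: ratio_upper L4 LD La (ltW Lap) _ (theta_ge _ Lp).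
  rewrite -kD -m0D -[X in _ + X + _]/(1%:R) -!natrD ler_nat.
  by apply: NleL => //; rewrite /k leq_addr.
have Nq : (1 / 4 - 1 / (100 * 100)) * q%:R `^ theta <= (N q%:R)%:R.
  apply: ratio_lower L4 LD (ltW Lq) _ _ (theta_le _ (ltW Lq)).
    by rewrite -natr1 lerD2r.
  by rewrite -kD ler_nat; apply: NgeL; exact: ltW.
have := near_l _ Lp; have := near_l _ (ltW Lq).
rewrite -(ler_pdivlMr _ _ (theta_gt0 _ (ltW Lq))) in Nq.
rewrite -(ler_pdivrMr _ _ (theta_gt0 _ Lp)) in Np.
rewrite !ltr_distl => /andP[/= + _] /andP[_ +].
by move: (_ / p%:R `^ _) Np (_ / q%:R `^ _) Nq => u + v; clear; lra.
Qed.

End Limit.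

Theorem theorem22 (K : fieldType) (R : realType) (charK2 : 2%N \in [pchar K]) :
  ~ exists l : R,
      (weight_growth K (n%:R : R))%:R / n%:R `^ (ln 2 / ln (golden R))
        @[n --> \oo] --> l.
Proof.
have growthE := weight_growthE charK2 (R := R).
by apply: no_growth_limit; [exact: growth_ge growthE | exact: growth_le growthE].
Qed.
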